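(* Fix $C>1$ and let $\delta=\delta(C)=C-1-\log C>0$. Fix $M>\frac1\delta$ and $0<\gamma<1$. There exists $\epsilon_1>0$ such that for every $0<\epsilon<\epsilon_1$ there is a positive constant $L_3$ such that, for all $n\ge L_3$, \[ \mathbb{P}(H_2)\ge 1-\gamma, \] where \[ H_2=\Big\{(1-q(C)-\gamma)n\le Y_n(\epsilon)\le(1-q(C)+\gamma)n\Big\}\cap\bigcap_{1\le j\le n}\Big(\{\#\mathcal{E}_j\le M\log n\}\cup\{\#\mathcal{E}_j>\epsilon n\}\Big), \] and $Y_n(\epsilon)=\sum_{i=1}^n\mathbf{1}(\#\mathcal{E}_i>\epsilon n)$.
   Context: Let $C>0$ be a constant and $(\alpha_n)_{n\ge1}$ a sequence of nonnegative reals with $\alpha_n\to0$. For each $n$, consider the complete graph $K_n$ on vertex set $\{1,\dots,n\}$; each edge $e$ of $K_n$ is independently open with probability $p_n(e)$ and closed otherwise, where $\frac{C-\alpha_n}{n}\le p_n(e)\le\frac{C+\alpha_n}{n}$ for every edge $e$. Let $G$ be the resulting random graph of open edges, with probability measure $\mathbb{P}$. For a vertex $i$, $\mathcal{E}_i$ denotes the open component of $G$ containing $i$ (the set of vertices joined to $i$ by a path of open edges, together with $i$ itself), and $\#\mathcal{E}_i$ its number of vertices. $\log$ is the natural logarithm. $T_1=1$ and for $r\ge2$, $T_r$ is the number of labelled trees on $r$ vertices; $q(C)=\sum_{r=1}^\infty \frac{T_rC^{r-1}e^{-Cr}}{(r-1)!}$. *)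

(* Defs.v *)
From HB Require Import structures.
From mathcomp Require Import all_boot all_order all_algebra.
From mathcomp Require Import all_classical all_reals all_analysis.
Set Implicit Arguments. Unset Strict Implicit. Unset Printing Implicit Defensive.
Import Order.TTheory GRing.Theory Num.Theory.
Local Open Scope ring_scope.

Definition adj (V : finType) (E : {set V * V}) : rel V :=
  fun x y => ((x, y) \in E) || ((y, x) \in E).

Definition is_labelled_tree (r : nat) (E : {set 'I_r * 'I_r}) : bool :=
  [forall e in E, (e.1 < e.2)%N] && (#|E| == r.-1) &&
  [forall x, [forall y, connect (adj E) x y]].

Definition T (r : nat) : nat := #|[set E : {set 'I_r * 'I_r} | is_labelled_tree E]|.

Definition q_term {R : realType} (C : R) (r : nat) : R :=
  (T r)%:R * C ^+ r.-1 * expR (- (C * r%:R)) / (r.-1)`!%:R.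

Definition q {R : realType} (C : R) : R :=
  limn (fun N => \sum_(1 <= r < N) q_term C r).

Definition is_graph (n : nat) (G : {set 'I_n * 'I_n}) : bool :=
  [forall e in G, (e.1 < e.2)%N].

(* probability of the outcome G when edge {i,j} (i<j) is open with
   probability p i j, independently *)
Definition graph_weight {R : realType} (n : nat) (p : 'I_n -> 'I_n -> R)
    (G : {set 'I_n * 'I_n}) : R :=
  \prod_(i : 'I_n) \prod_(j : 'I_n | (i < j)%N)
     (if (i, j) \in G then p i j else 1 - p i j).

Definition Prob {R : realType} (n : nat) (p : 'I_n -> 'I_n -> R)
    (A : pred {set 'I_n * 'I_n}) : R :=
  \sum_(G : {set 'I_n * 'I_n} | is_graph G && A G) graph_weight p G.

Definition comp_size (n : nat) (G : {set 'I_n * 'I_n}) (i : 'I_n) : nat :=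
  #|[set j | connect (adj G) i j]|.

Definition Y {R : realType} (n : nat) (eps : R) (G : {set 'I_n * 'I_n}) : nat :=
  #|[set i : 'I_n | eps * n%:R < (comp_size G i)%:R]|.

Definition H2 {R : realType} (n : nat) (C M gamma eps : R)
    (G : {set 'I_n * 'I_n}) : bool :=
  ((1 - q C - gamma) * n%:R <= (Y eps G)%:R <= (1 - q C + gamma) * n%:R) &&
  [forall j : 'I_n, ((comp_size G j)%:R <= M * ln (n%:R : R))
                    || (eps * n%:R < (comp_size G j)%:R)].

(* Main.v *)
(* The vertices in components of size [r] number [r] times the components of
   size [r], and a vertex set [S] of size [r] is a component exactly when it
   carries a spanning tree of open edges and has no open edge to its
   complement. With [a = (C - alpha_n)/n] and [b = (C + alpha_n)/n], the union
   bound over trees on [S] gives a mean of at most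
   [r C(n,r) T_r b^(r-1) e^(-a r (n-r))]; prescribing that the open edges
   touching [S] form a given tree yields disjoint events, and a lower bound with
   the same asymptotics. Hence for fixed [r] the mean divided by [n] tends to the
   [r]-th term of [q(C)], whose partial sums are therefore at most 1.

   Rooting trees gives [T_r <= r^(r-1)], so for [r <= eps n] the mean is at most
   [n e^(-(delta - o(1)) r)]: the expected number of vertices in components of
   size between [t] and [eps n] decays geometrically in [t]. Taking [t] a large
   constant [K], resp. [t = M log n], disposes of the middle range. The number of
   vertices in components of size at most [K] changes by at most [2K] when one
   edge is flipped, so its variance is [O(n)] by the Efron--Stein inequality and
   it concentrates around [q(C) n]. *)
Require Import Defs.
From HB Require Import structures.
From mathcomp Require Import all_boot all_order all_algebra.
From mathcomp Require Import all_classical all_reals all_analysis.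
From mathcomp Require Import ring lra.
Set Implicit Arguments. Unset Strict Implicit. Unset Printing Implicit Defensive.
Import Order.TTheory GRing.Theory Num.Theory.
Import numFieldNormedType.Exports.
From mathcomp Require Import fintype finset.
Local Open Scope ring_scope.


(** * Expectation and variance under a product of Bernoulli weights on the subsets of a finite
    set *)

Section ProductMeasure.
Variables (R : realFieldType) (I : finType) (P : I -> R).

Definition wt (G : {set I}) : R := \prod_e (if e \in G then P e else 1 - P e).
Definition Ex (f : {set I} -> R) : R := \sum_G wt G * f G.

Lemma ExZ (k : R) (f : {set I} -> R) : Ex (fun G => k * f G) = k * Ex f.
Proof.
by rewrite /Ex mulr_sumr; apply: eq_bigr => G _; rewrite mulrCA.
Qed.

Lemma ExD (f g : {set I} -> R) : Ex (fun G => f G + g G) = Ex f + Ex g.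
Proof. by rewrite /Ex -big_split /=; apply: eq_bigr => G _; rewrite mulrDr. Qed.

Lemma Ex_sum (J : Type) (s : seq J) (Q : pred J) (f : J -> {set I} -> R) :
  Ex (fun G => \sum_(j <- s | Q j) f j G) = \sum_(j <- s | Q j) Ex (f j).
Proof.
by rewrite /Ex exchange_big /=; apply: eq_bigr => G _; rewrite mulr_sumr.
Qed.

(** Expanding the product of the sums [F1 e + F2 e] by distributivity gives one term for each [G].
    Since [F1] vanishes on [K] and [F2] on [O], only the sets that contain [O] and avoid [K]
    survive. *)
Lemma Ex_cylinder (O K : {set I}) : [disjoint O & K] ->
  Ex (fun G => ((O \subset G) && [disjoint K & G])%:R)
  = \prod_(e in O) P e * \prod_(e in K) (1 - P e).
Proof.
move=> dOK.
pose F1 e := if e \in K then 0 else P e.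
pose F2 e := if e \in O then 0 else 1 - P e.
have OK e : e \in O -> e \in K = false by move=> eO; rewrite (disjointFr dOK eO).
transitivity (\prod_e (F1 e + F2 e)).
  rewrite bigA_distr; apply: eq_bigr => G _.
  have [/andP[/subsetP OG dKG]|H] := boolP (_ && _).
    rewrite mulr1; apply: eq_bigr => e _; rewrite /F1 /F2.
    case: ifPn => eG; first by rewrite (disjointFl dKG eG).
    by case: ifPn => // /OG; rewrite (negbTE eG).
  rewrite mulr0; apply/esym; move: H; rewrite negb_and => /orP[].
    move=> /subsetPn[e eO eG]; rewrite (bigD1 e) //= (negbTE eG) /F2 eO.
    by rewrite mul0r.
  move=> /pred0Pn[e /= /andP[eK eG]].
  by rewrite (bigD1 e) //= eG /F1 eK mul0r.
rewrite (big_mkcond (mem O)) (big_mkcond (mem K)) -big_split /=.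
apply: eq_bigr => e _; rewrite /F1 /F2.
case: (boolP (e \in O)) => [/OK ->|_]; first by rewrite addr0 mulr1.
by case: ifP => _; rewrite ?add0r ?mul1r // addrC subrK.
Qed.

Lemma Ex1 : Ex (fun=> 1) = 1.
Proof.
have := Ex_cylinder (O := set0) (K := set0).
rewrite -setI_eq0 set0I eqxx !big_set0 mulr1 => /(_ isT) H.
by rewrite -[RHS]H; apply: eq_bigr => G _; rewrite sub0set -setI_eq0 set0I eqxx.
Qed.

Lemma Ex_cst k : Ex (fun=> k) = k.
Proof. by rewrite -[X in Ex (fun=> X)]mulr1 ExZ Ex1 mulr1. Qed.

(** Conditional expectation of [f] given all coordinates other than [e]. *)
Definition avg e (f : {set I} -> R) (G : {set I}) : R :=
  P e * f (e |: G) + (1 - P e) * f (G :\ e).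

Lemma Ex_split e f : Ex f = \sum_(G : {set I} | e \notin G)
  (\prod_(i | i != e) (if i \in G then P i else 1 - P i)) *
  (P e * f (e |: G) + (1 - P e) * f G).
Proof.
rewrite /Ex (bigID (fun G : {set I} => e \in G)) /=.
rewrite (reindex_onto (fun G => e |: G) (fun G => G :\ e)) /=; last first.
  by move=> G eG; rewrite setD1K.
rewrite (eq_bigl (fun G : {set I} => e \notin G)); last first.
  move=> G; rewrite setU11 /=; apply/eqP/idP => [<-|eG]; last by rewrite setU1K.
  by rewrite setD11.
rewrite -big_split /=; apply: eq_bigr => G eG.
rewrite /wt (bigD1 e) //= [X in _ + X](_ : _ = (\prod_i (if i \in G then P i else 1 - P i)) * f G) //.
rewrite [X in _ + X * _](bigD1 e) //= setU11 (negbTE eG).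
have -> : \prod_(i | i != e) (if i \in e |: G then P i else 1 - P i)
        = \prod_(i | i != e) (if i \in G then P i else 1 - P i).
  by apply: eq_bigr => i ie; rewrite in_setU1 (negbTE ie).
by ring.
Qed.

Lemma avgU e f G : avg e f (e |: G) = avg e f G.
Proof.
rewrite /avg setUA setUid; congr (_ + _ * f _).
by apply/setP => x; rewrite !inE; case: eqP.
Qed.

Lemma Ex_avg e f : Ex (avg e f) = Ex f.
Proof.
rewrite !(Ex_split e); apply: eq_bigr => G eG; rewrite avgU /avg.
have -> : G :\ e = G by apply/setP => x; rewrite !inE; case: eqP => // ->; rewrite (negbTE eG).
by ring.
Qed.

Hypothesis P01 : forall e, 0 <= P e <= 1.

Lemma wt_ge0 G : 0 <= wt G.
Proof.
apply: prodr_ge0 => e _; case/andP: (P01 e) => h0 h1.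
by case: ifP => _ //; rewrite subr_ge0.
Qed.

(** The comparison is required only where the weight is nonzero, so that random edge sets can later
    be assumed to be genuine graphs. *)
Lemma Ex_le f g : (forall G, wt G != 0 -> f G <= g G) -> Ex f <= Ex g.
Proof.
move=> fg; apply: ler_sum => G _.
have [->|nz] := eqVneq (wt G) 0; first by rewrite !mul0r.
by rewrite ler_wpM2l ?wt_ge0 ?fg.
Qed.

(** Given the other coordinates, [f] takes two values [x] and [y]; its conditional variance
    [P e * (1 - P e) * (x - y)^2] is at most [P e * K^2]. *)
Lemma Ex_sqr_avg e f K : (forall G, `|f (e |: G) - f (G :\ e)| <= K) ->
  Ex (fun G => f G ^+ 2) <= Ex (fun G => avg e f G ^+ 2) + K ^+ 2 * P e.
Proof.
move=> fK; case/andP: (P01 e) => h0 h1.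
rewrite -[X in _ <= _ + X]Ex_cst -ExD !(Ex_split e); apply: ler_sum => G eG.
have Ge : G :\ e = G by apply/setP => x; rewrite !inE; case: eqP => // ->; rewrite (negbTE eG).
apply: ler_wpM2l.
  apply: prodr_ge0 => i _; case/andP: (P01 i) => i0 i1.
  by case: ifP => _ //; rewrite subr_ge0.
rewrite avgU /avg Ge.
have := fK G; rewrite Ge.
set x := f _; set y := f _ => xy.
have xy2 : (x - y) ^+ 2 <= K ^+ 2.
  by rewrite -real_normK ?num_real // lerXn2r ?nnegrE // (le_trans _ xy).
have h : P e * (1 - P e) * (x - y) ^+ 2 <= P e * K ^+ 2.
  rewrite -mulrA ler_wpM2l // (le_trans _ xy2) // -[leRHS]mul1r ler_wpM2r ?sqr_ge0 //.
  by lra.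
rewrite -subr_ge0; rewrite -subr_ge0 in h.
by apply: (le_trans h); rewrite le_eqVlt; apply/orP; left; apply/eqP; ring.
Qed.

(** Averaging over [e] is a convex combination, which cannot increase the oscillation in another
    coordinate; in the coordinate [e] itself the average is constant. *)
Lemma avg_osc e e' f K : (forall G, `|f (e' |: G) - f (G :\ e')| <= K) ->
  forall G, `|avg e f (e' |: G) - avg e f (G :\ e')| <= K.
Proof.
move=> fK G; case/andP: (P01 e) => h0 h1.
have K0 : 0 <= K by apply: le_trans (fK G).
have [<-|ne] := eqVneq e e'.
  rewrite avgU -(avgU e f (G :\ e)) (_ : e |: (G :\ e) = e |: G) ?avgU ?subrr ?normr0 //.
  by apply/setP => x; rewrite !inE; case: eqP.
rewrite /avg setUCA (_ : (e' |: G) :\ e = e' |: (G :\ e)); last first.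
  by apply/setP => x; rewrite !inE; case: (eqVneq x e) => // ->; rewrite (negbTE ne).
rewrite (_ : e |: (G :\ e') = (e |: G) :\ e'); last first.
  by apply/setP => x; rewrite !inE; case: (eqVneq x e) => // ->; rewrite ne.
rewrite (_ : G :\ e' :\ e = G :\ e :\ e'); last first.
  by apply/setP => x; rewrite !inE andbCA.
have -> (a b c d : R) : P e * a + (1 - P e) * b - (P e * c + (1 - P e) * d)
  = P e * (a - c) + (1 - P e) * (b - d) by ring.
apply: (le_trans (ler_normD _ _)); rewrite !normrM (ger0_norm h0) (@ger0_norm _ (1 - P e)) ?subr_ge0 //.
have -> : K = P e * K + (1 - P e) * K by ring.
by apply: lerD; apply: ler_wpM2l; rewrite ?subr_ge0.
Qed.

Lemma osc0_const (f : {set I} -> R) :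
  (forall e G, f (e |: G) = f (G :\ e)) -> forall G, f G = f set0.
Proof.
move=> f0 G; have [n] := ubnP #|G|; elim: n G => // n IH G.
have [->//|[e eG]] := set_0Vmem G.
rewrite (cardsD1 e) eG ltnS => ltn.
by rewrite -(IH (G :\ e)) // -f0; congr f; apply/esym/setUidPr; rewrite sub1set.
Qed.

(* Bounded-difference form of the Efron--Stein inequality. *)
Lemma variance_le f K : (forall e G, `|f (e |: G) - f (G :\ e)| <= K) ->
  Ex (fun G => f G ^+ 2) - Ex f ^+ 2 <= K ^+ 2 * \sum_e P e.
Proof.
move=> fK; rewrite -big_enum /=.
(* The list in the induction holds the coordinates on which [f] may still depend. Averaging out its
   head costs [K^2 * P e] in the second moment, keeps the mean and preserves the oscillation
   bounds. *)
have : forall e G, e \notin enum I -> f (e |: G) = f (G :\ e) by move=> e G; rewrite mem_enum.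
elim: (enum I) f fK => [|e s IH] f fK f0.
  have /osc0_const fc : forall e G, f (e |: G) = f (G :\ e) by move=> e G; exact: f0.
  rewrite (_ : Ex (fun G => f G ^+ 2) = f set0 ^+ 2); last first.
    by rewrite -[RHS]Ex_cst; apply: eq_bigr => G _; rewrite fc.
  rewrite (_ : Ex f = f set0) ?subrr ?big_nil ?mulr0 //.
  by rewrite -[RHS]Ex_cst; apply: eq_bigr => G _; rewrite fc.
rewrite big_cons mulrDr.
have := Ex_sqr_avg (fK e).
have := IH (avg e f) (fun e' => avg_osc e (fK e')).
rewrite Ex_avg => h1 h2; apply: (le_trans (lerB h2 (lexx _))).
rewrite addrAC addrC lerD2l; apply: h1 => e' G e's.
apply/eqP; rewrite -subr_eq0 -normr_le0.
have [->|ne] := eqVneq e' e.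
  rewrite avgU -(avgU e f (G :\ e)) (_ : e |: (G :\ e) = e |: G) ?avgU ?subrr ?normr0 //.
  by apply/setP => x; rewrite !inE; case: eqP.
apply: avg_osc => {}G; rewrite f0 ?subrr ?normr0 //.
by rewrite inE negb_or ne.
Qed.

Lemma Ex_markov (f : {set I} -> R) (t : R) : 0 < t -> (forall G, 0 <= f G) ->
  Ex (fun G => (t <= f G)%R%:R) <= Ex f / t.
Proof.
move=> t0 f0; rewrite mulrC -ExZ; apply: Ex_le => G _.
case: (boolP (t <= f G)) => h /=; last by rewrite mulr_ge0 ?invr_ge0 // ltW.
by rewrite mulrC ler_pdivlMr // mul1r.
Qed.

Lemma Ex_chebyshev (f : {set I} -> R) (K t : R) : 0 < t -> (forall e G, `|f (e |: G) - f (G :\ e)| <= K) ->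
  Ex (fun G => (t <= `|f G - Ex f|)%R%:R) <= K ^+ 2 * (\sum_e P e) / t ^+ 2.
Proof.
move=> t0 fK.
apply: (@le_trans _ _ (Ex (fun G => (t ^+ 2 <= (f G - Ex f) ^+ 2)%R%:R))).
  apply: Ex_le => G _; rewrite -[(_ - _) ^+ 2]real_normK ?num_real //.
  by rewrite ler_pXn2r ?nnegrE // ltW.
apply: (le_trans (Ex_markov (exprn_gt0 2 t0) _)) => [G|]; first exact: sqr_ge0.
apply: ler_wpM2r; first by rewrite invr_ge0 sqr_ge0.
apply: le_trans (variance_le fK); rewrite le_eqVlt; apply/orP; left; apply/eqP.
transitivity (Ex (fun G => f G ^+ 2 + ((- 2 * Ex f) * f G + Ex f ^+ 2 * 1))).
  by apply: eq_bigr => G _; ring.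
by rewrite !ExD !ExZ Ex1; ring.
Qed.

End ProductMeasure.

(** * Spanning trees and a bound on the number of labelled trees *)

Section Trees.
Local Open Scope nat_scope.

Lemma connect_invariant (V : finType) (e : rel V) (Q : V -> Prop) x y :
  (forall u v, Q u -> e u v -> Q v) -> Q x -> connect e x y -> Q y.
Proof.
move=> cl Qx /connectP[p pth ->]; elim: p x Qx pth => //= z p IH x Qx /andP[xz].
by apply: IH; apply: cl xz.
Qed.

Lemma adj_sym (V : finType) (E : {set V * V}) x y : adj E x y = adj E y x.
Proof. by rewrite /adj orbC. Qed.

Lemma connect_adj_sym (V : finType) (E : {set V * V}) : connect_sym (adj E).
Proof. by apply: sym_connect_sym => x y; exact: adj_sym. Qed.

Lemma adjS (V : finType) (E E' : {set V * V}) x y : E \subset E' -> adj E x y -> adj E' x y.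
Proof. by move=> /subsetP s /orP[/s|/s] h; rewrite /adj h ?orbT. Qed.

Lemma connect_adjS (V : finType) (E E' : {set V * V}) x y :
  E \subset E' -> connect (adj E) x y -> connect (adj E') x y.
Proof.
move=> s; apply: connect_sub => {}x {}y h; apply: connect1; exact: adjS h.
Qed.

Definition norm_edge n (u v : 'I_n) := if u < v then (u, v) else (v, u).

Lemma graph_lt n (G : {set 'I_n * 'I_n}) e : is_graph G -> e \in G -> e.1 < e.2.
Proof. by move=> /forallP /(_ e) /implyP; apply. Qed.

Lemma norm_edge_in n (G : {set 'I_n * 'I_n}) u v :
  is_graph G -> adj G u v -> norm_edge u v \in G.
Proof.
move=> gG /orP[] h; have /= lt := graph_lt gG h; rewrite /norm_edge ?lt //.
by rewrite ltnNge (ltnW lt).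
Qed.

Lemma norm_edge_adj n (G : {set 'I_n * 'I_n}) u v : norm_edge u v \in G -> adj G u v.
Proof. by rewrite /norm_edge /adj; case: ifP => _ ->; rewrite ?orbT. Qed.

(** The vertices other than the root [ord0] are the [lift ord0 k]; the map [g] gives each of them a
    parent. *)
Definition parent_edges m (g : {ffun 'I_m -> 'I_m.+1}) : {set 'I_m.+1 * 'I_m.+1} :=
  [set norm_edge (lift ord0 k) (g k) | k in 'I_m].

(** The tree grows from the root one vertex at a time, [S] being the vertices reached and [f] the
    parent map. Keeping all edges of [E] inside [S] guarantees that each added edge is new. *)
Lemma grow_tree m (H : {set 'I_m.+1 * 'I_m.+1}) k :
  is_graph H -> (forall x y, connect (adj H) x y) -> k <= m ->
  exists (S : {set 'I_m.+1}) (f : 'I_m.+1 -> 'I_m.+1),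
    let E := [set norm_edge v (f v) | v in S :\ ord0] in
    [/\ #|S| = k.+1, ord0 \in S, E \subset H, #|E| = k &
      (forall e, e \in E -> (e.1 \in S) && (e.2 \in S)) /\
      (forall v, v \in S -> connect (adj E) ord0 v)].
Proof.
move=> gH cH; elim: k => [|k IH] km.
  exists [set ord0], id.
  have -> : [set ord0] :\ ord0 = set0 :> {set 'I_m.+1} by rewrite setDv.
  rewrite imset0 /= cards1 cards0 sub0set set11; split=> //; split.
    by move=> e; rewrite inE.
  by move=> v /set1P ->; exact: connect0.
have [S [f /= [cS S0 EH cE [ES EC]]]] := IH (ltnW km).
set E := [set _ | _ in _] in EH cE ES EC.
(* If no edge left [S], everything reachable from the root would lie in [S], contradicting the
   vertex [w]. *)
have [u [v [uS vS uv]]] : exists u v, [/\ u \in S, v \notin S & adj H u v].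
  have /subsetPn[w _ wS] : ~~ ([set: 'I_m.+1] \subset S).
    by apply/negP => /subset_leq_card; rewrite cardsT card_ord cS ltnS leqNgt km.
  apply: contrapT => no; move: wS; apply/negP; rewrite negbK.
  apply: (connect_invariant (Q := fun z => z \in S)) S0 (cH ord0 w) => a b aS ab.
  by apply: contrapT => /negP bS; apply: no; exists a, b.
pose f' w := if w == v then u else f w.
have v0 : v != ord0 by apply: contraNneq vS => ->.
exists (v |: S), f'.
have -> : (v |: S) :\ ord0 = v |: (S :\ ord0).
  by apply/setP => x; rewrite !inE; case: (eqVneq x v) => // ->; rewrite v0.
have -> : [set norm_edge w (f' w) | w in v |: (S :\ ord0)] = norm_edge v u |: E.
  rewrite imsetU1 /f' eqxx; congr (_ |: _); apply: eq_in_imset => w.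
  by rewrite !inE => /andP[_ wS]; case: eqP => // wv; rewrite -wv wS in vS.
have nE : norm_edge v u \notin E.
  apply/negP => /ES; rewrite /norm_edge; case: ifP => _ /=; rewrite (negbTE vS) ?andbF //.
split.
- by rewrite cardsU1 vS cS.
- by rewrite in_setU S0 orbT.
- by rewrite subUset EH andbT sub1set norm_edge_in // adj_sym.
- by rewrite cardsU1 nE cE.
have cu : connect (adj (norm_edge v u |: E)) ord0 u.
  by apply: connect_adjS (EC u uS); exact: subsetUr.
split.
  move=> e /setU1P[->|/ES /andP[e1 e2]]; last by rewrite !inE e1 e2 !orbT.
  by rewrite /norm_edge; case: ifP => _ /=; rewrite !inE eqxx uS !orbT.
move=> w /setU1P[->|/EC]; last by apply: connect_adjS; exact: subsetUr.
apply: connect_trans cu _; apply: connect1; rewrite adj_sym; apply: norm_edge_adj.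
exact: setU11.
Qed.

Lemma spanning_tree m (H : {set 'I_m.+1 * 'I_m.+1}) :
  is_graph H -> (forall x y, connect (adj H) x y) ->
  exists g : {ffun 'I_m -> 'I_m.+1},
    (parent_edges g \subset H) && is_labelled_tree (parent_edges g).
Proof.
move=> gH cH; have [S [f /= [cS S0 EH cE [ES EC]]]] := grow_tree gH cH (leqnn m).
have ST : S = setT.
  by apply/eqP; rewrite eqEcard subsetT cS cardsT card_ord leqnn.
exists [ffun k => f (lift ord0 k)].
have -> : parent_edges [ffun k => f (lift ord0 k)]
    = [set norm_edge v (f v) | v in S :\ ord0].
  apply/setP => e; apply/imsetP/imsetP => [[k _ ->]|[v]].
    by exists (lift ord0 k); rewrite ?ffunE // ST !inE.
  rewrite ST !inE andbT eq_sym => /unlift_some[k -> _] ->.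
  by exists k; rewrite ?ffunE.
rewrite EH andTb /is_labelled_tree cE eqxx andbT; apply/andP; split.
  by apply/forallP => e; apply/implyP => /(subsetP EH); exact: graph_lt.
apply/forallP => x; apply/forallP => y.
have C0 z : connect (adj [set norm_edge v (f v) | v in S :\ ord0]) ord0 z.
  by apply: EC; rewrite ST inE.
by apply: connect_trans (C0 y); rewrite connect_adj_sym.
Qed.

Lemma treeP r (E : {set 'I_r * 'I_r}) : is_labelled_tree E ->
  [/\ is_graph E, #|E| = r.-1 & forall x y, connect (adj E) x y].
Proof.
move=> /andP[/andP[gE /eqP cE] /forallP cn]; split=> // x y.
by have /forallP := cn x.
Qed.

(** A spanning tree of a tree has as many edges as the tree and so equals it. Every labelled tree is
    therefore [parent_edges g] for one of the [m.+1 ^ m] maps [g]. *)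
Lemma T_leq m : T m.+1 <= m.+1 ^ m.
Proof.
have -> : m.+1 ^ m = #|[set: {ffun 'I_m -> 'I_m.+1}]|.
  by rewrite cardsT card_ffun !card_ord.
apply: leq_trans (leq_imset_card (@parent_edges m) _).
apply/subset_leq_card/subsetP => E; rewrite inE => /treeP[gE cE cn].
have [g /andP[gs /treeP[_ cg _]]] := spanning_tree gE cn.
apply/imsetP; exists g => //; apply/esym/eqP.
by rewrite eqEcard gs cE cg leqnn.
Qed.

End Trees.

(** * Components of a graph and trees embedded in a vertex set *)

Section Components.
Local Open Scope nat_scope.
Variable n : nat.
Implicit Types (G : {set 'I_n.+1 * 'I_n.+1}) (S : {set 'I_n.+1}).

Definition comp G i := [set j | connect (adj G) i j].
(** Holds vacuously for the empty set, so it characterises components only among nonempty [S]. *)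
Definition is_comp G S := [forall i in S, comp G i == S].
(** Closing all of [cross S] isolates [S], which serves the upper bound; prescribing the state of
    all of [touch S] makes the events of different trees disjoint, which serves the lower bound. *)
Definition cross S := [set e : 'I_n.+1 * 'I_n.+1 | (e.1 < e.2) && ((e.1 \in S) != (e.2 \in S))].
Definition touch S := [set e : 'I_n.+1 * 'I_n.+1 | (e.1 < e.2) && ((e.1 \in S) || (e.2 \in S))].
(* Order-preserving enumeration of [S], when [#|S| = r]. *)
Definition emb S r (k : 'I_r) : 'I_n.+1 := nth ord0 (enum S) k.
Definition emb_edges S r (E : {set 'I_r * 'I_r}) :=
  [set (emb S e.1, emb S e.2) | e in E].

Section Embedding.
Variables (S : {set 'I_n.+1}) (r : nat).
Hypothesis cS : #|S| = r.

Lemma emb_in (k : 'I_r) : emb S k \in S.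
Proof. by rewrite -mem_enum mem_nth // -cardE cS. Qed.

Lemma emb_surj x : x \in S -> exists k : 'I_r, x = emb S k.
Proof.
move=> xS; have lt : index x (enum S) < r by rewrite -cS cardE index_mem mem_enum.
by exists (Ordinal lt); rewrite /emb nth_index // mem_enum.
Qed.

(** [enum S] filters the increasing enumeration of the ordinals. Monotonicity keeps embedded edges
    in the increasing form in which graphs store them. *)
Lemma emb_lt (k l : 'I_r) : k < l -> emb S k < emb S l.
Proof.
move=> kl.
have srt : sorted (fun x y : 'I_n.+1 => x < y) (enum S).
  rewrite {1}/enum_mem; apply: sorted_filter => [x y z|]; first exact: ltn_trans.
  have := iota_ltn_sorted 0 n.+1; rewrite -val_enum_ord sorted_map.
  by rewrite enumT.
have tr : transitive (fun x y : 'I_n.+1 => x < y) by move=> x y z; exact: ltn_trans.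
have := sorted_ltn_nth tr ord0 srt; apply => //; by rewrite inE -cardE cS.
Qed.

Lemma emb_mono (k l : 'I_r) : (emb S k < emb S l) = (k < l).
Proof.
case: (ltngtP k l) => [/emb_lt //|/emb_lt h|/val_inj ->]; last by rewrite ltnn.
by rewrite ltnNge ltnW.
Qed.

Lemma emb_inj : injective (fun k : 'I_r => emb S k).
Proof.
move=> k l e; apply: val_inj; case: (ltngtP k l) => // /emb_lt; by rewrite e ltnn.
Qed.

Lemma emb_edge_inj : injective (fun e : 'I_r * 'I_r => (emb S e.1, emb S e.2)).
Proof. by move=> [a b] [c d] [/emb_inj /= -> /emb_inj /= ->]. Qed.

Lemma mem_emb_edges (E : {set 'I_r * 'I_r}) k l :
  ((emb S k, emb S l) \in emb_edges S E) = ((k, l) \in E).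
Proof. by rewrite -(mem_imset E (k, l) emb_edge_inj). Qed.

Lemma adj_emb_edges (E : {set 'I_r * 'I_r}) k l :
  adj (emb_edges S E) (emb S k) (emb S l) = adj E k l.
Proof. by rewrite /adj !mem_emb_edges. Qed.

Lemma emb_edges_in (E : {set 'I_r * 'I_r}) e :
  e \in emb_edges S E -> (e.1 \in S) && (e.2 \in S).
Proof. by move=> /imsetP[x _ ->]; rewrite !emb_in. Qed.

(** The pullback [H] of [G] along the enumeration of [S] is connected, because paths of [G] starting
    in [S] stay in [S]; a spanning tree of [H] is then embedded back. *)
Lemma is_comp_spanning_tree G : 0 < r -> is_graph G -> is_comp G S ->
  exists E : {set 'I_r * 'I_r},
    [&& is_labelled_tree E, emb_edges S E \subset G & [disjoint cross S & G]].
Proof.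
move=> r0 gG /forallP icS.
have inS i : i \in S -> comp G i = S by move=> iS; apply/eqP; have /implyP := icS i; apply.
pose H := [set e : 'I_r * 'I_r | (emb S e.1, emb S e.2) \in G].
have adjH k l : adj G (emb S k) (emb S l) = adj H k l by rewrite /adj !inE.
have gH : is_graph H.
  by apply/forallP => e; apply/implyP; rewrite inE => /(graph_lt gG); rewrite emb_mono.
have closedS x y : x \in S -> adj G x y -> y \in S.
  by move=> xS xy; rewrite -(inS x xS) inE connect1.
have cH k l : connect (adj H) k l.
  have : emb S l \in comp G (emb S k) by rewrite inS ?emb_in.
  rewrite inE => c.
  (* The path in [G] is lifted vertex by vertex to a path in [H]. *)
  have [l' e] : exists2 l', emb S l = emb S l' & connect (adj H) k l'.
    apply: (connect_invariant (Q := fun x => exists2 l', x = emb S l' & connect (adj H) k l')) c.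
      move=> _ v [l' -> c] uv.
      have [m vm] := emb_surj (closedS _ _ (emb_in l') uv).
      exists m => //; apply: connect_trans c _; apply: connect1.
      by rewrite -adjH -vm.
    by exists k.
  by rewrite (emb_inj e).
have [E /andP[EH tE]] : exists E : {set 'I_r * 'I_r}, (E \subset H) && is_labelled_tree E.
  case: r r0 H gH cH {adjH} => // m _ H gH cH.
  by have [g ?] := spanning_tree gH cH; exists (parent_edges g).
exists E; rewrite tE /=; apply/andP; split.
  apply/subsetP => _ /imsetP[e /(subsetP EH) eH ->]; by rewrite inE in eH.
rewrite disjoint_subset; apply/subsetP => -[x y]; rewrite !inE /= => /andP[_ ne].
apply: contraNN ne => xy; apply/eqP.
have axy : adj G x y by rewrite /adj xy.
apply/idP/idP => h; first exact: closedS axy.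
by apply: closedS h _; rewrite adj_sym.
Qed.

(** The open edges touching [S] are exactly those of the tree. The second conclusion recovers the
    tree from [G], so that two different trees cannot both occur. *)
Lemma tree_is_comp G (E : {set 'I_r * 'I_r}) : is_graph G -> is_labelled_tree E ->
  emb_edges S E \subset G -> [disjoint touch S :\: emb_edges S E & G] ->
  is_comp G S /\ emb_edges S E = G :&: touch S.
Proof.
move=> gG /treeP[gE cE cn] EG dis.
have out e : e \in G -> e \in touch S -> e \in emb_edges S E.
  by move=> eG et; have := disjointFl dis eG; rewrite inE et andbT => /negbFE.
have Et : emb_edges S E = G :&: touch S.
  apply/eqP; rewrite eqEsubset; apply/andP; split; apply/subsetP => e.
    move=> eE; rewrite inE (subsetP EG) //= inE (graph_lt gG) ?(subsetP EG) //.
    by have /andP[-> _] := emb_edges_in eE.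
  by rewrite inE => /andP[]; exact: out.
split=> //; apply/forallP => i; apply/implyP => iS; apply/eqP/setP => j.
rewrite inE; apply/idP/idP => [c|jS].
  apply: (connect_invariant (Q := fun x => x \in S)) iS c => u v uS /orP[] h.
    have /emb_edges_in/andP[] // : (u, v) \in emb_edges S E.
    by apply: out => //; rewrite inE (graph_lt gG h) uS.
  have /emb_edges_in/andP[] // : (v, u) \in emb_edges S E.
  by apply: out => //; rewrite inE (graph_lt gG h) uS orbT.
have [k ->] := emb_surj iS; have [l ->] := emb_surj jS.
apply: (connect_invariant (Q := fun x => connect (adj G) (emb S k) (emb S x))) (cn k l) => // u v c uv.
apply: connect_trans c _; apply: connect1; apply: adjS EG _.
by rewrite adj_emb_edges.
Qed.

Lemma card_emb_edges (E : {set 'I_r * 'I_r}) : #|emb_edges S E| = #|E|.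
Proof. by apply: card_imset; exact: emb_edge_inj. Qed.

Lemma disjoint_emb_cross (E : {set 'I_r * 'I_r}) : [disjoint emb_edges S E & cross S].
Proof.
rewrite disjoint_subset; apply/subsetP => e /emb_edges_in /andP[e1 e2].
by rewrite !inE e1 e2 /= andbF.
Qed.

(** Ordering the endpoints of a pair in [S] times its complement is injective, since the endpoint
    lying in [S] tells which came first. *)
Lemma card_cross : r * (n.+1 - r) <= #|cross S|.
Proof.
have -> : r * (n.+1 - r) = #|finset.setX S (~: S)|.
  by rewrite cardsX -[X in X - r](card_ord n.+1) -(cardsC S) cS addKn.
rewrite -(@card_in_imset _ _ (fun e => norm_edge e.1 e.2) [in finset.setX S (~: S)]).
  apply/subset_leq_card/subsetP => e /imsetP[[x y]]; rewrite !inE /= => /andP[xS yS] ->.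
  rewrite /norm_edge; case: (ltngtP x y) => [lt|lt|/val_inj xy] /=.
  - by rewrite lt xS (negbTE yS).
  - by rewrite lt xS (negbTE yS).
  - by rewrite xy (negbTE yS) in xS.
move=> [x y] [z t]; rewrite !inE /= => /andP[xS yS] /andP[zS tS].
rewrite /norm_edge; case: ifP => _; case: ifP => _ [e1 e2]; subst => //.
  by rewrite xS in tS.
by rewrite xS in tS.
Qed.

Lemma card_touch : #|touch S| <= r * n.+1.
Proof.
have -> : r * n.+1 = #|finset.setX S [set: 'I_n.+1]| by rewrite cardsX cardsT card_ord cS.
apply: leq_trans (leq_imset_card (fun e => norm_edge e.1 e.2) _).
apply/subset_leq_card/subsetP => -[x y]; rewrite inE /= => /andP[lt /orP[xS|yS]].
  by apply/imsetP; exists (x, y); rewrite ?inE ?xS //= /norm_edge lt.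
by apply/imsetP; exists (y, x); rewrite ?inE ?yS //= /norm_edge ltnNge ltnW.
Qed.

End Embedding.

(** Counts vertices, not components. *)
Definition ncomp G r := #|[set i : 'I_n.+1 | comp_size G i == r]|.

(** Double counting of the pairs of a vertex and a component of size [r] containing it. For [r = 0]
    the factor [r] cancels the contribution of the empty set. *)
Lemma ncompE G r : ncomp G r = r * #|[set S : {set 'I_n.+1} | (#|S| == r) && is_comp G S]|.
Proof.
transitivity (\sum_(i : 'I_n.+1) \sum_(S : {set 'I_n.+1} | (#|S| == r) && is_comp G S) (i \in S : nat)).
  rewrite /ncomp -sum1_card big_mkcond /=; apply: eq_bigr => i _.
  rewrite -big_mkcondr /= sum1dep_card inE /comp_size.
  case: ifP => h; last first.
    apply/esym/eqP; rewrite cards_eq0; apply/eqP/setP => S; rewrite !inE.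
    apply: contraFF h => /andP[/andP[/eqP cS /forallP /(_ i) + ] iS]; rewrite iS /= => /eqP e.
    by rewrite -/(comp G i) e cS.
  apply/esym/eqP/cards1P; exists (comp G i); apply/setP => S; rewrite !inE.
  apply/idP/eqP => [/andP[/andP[_ /forallP /(_ i) +] iS]|->].
    by rewrite iS /= => /eqP.
  rewrite h inE connect0 andbT /=; apply/forallP => j; apply/implyP.
  rewrite inE => c; apply/eqP/setP => k; rewrite !inE.
  by rewrite (same_connect (@connect_adj_sym _ G) c).
rewrite exchange_big /= (eq_bigr (fun=> r)) ?sum_nat_const 1?mulnC ?cardsE //.
by move=> S /andP[/eqP <- _]; rewrite -big_mkcond sum1_card.
Qed.

End Components.

(** * Effect of a single edge on the number of vertices in small components *)

Section SmallComponents.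
Local Open Scope nat_scope.
Variable n : nat.
Implicit Types (G : {set 'I_n.+1 * 'I_n.+1}) (K : nat).

Definition nsmall K G := #|[set i : 'I_n.+1 | comp_size G i <= K]|.

Lemma comp_setU1 G e i : e.1 \notin comp G i -> e.2 \notin comp G i ->
  comp (e |: G) i \subset comp G i.
Proof.
move=> e1 e2; apply/subsetP => j; rewrite inE => c.
apply: (connect_invariant (Q := fun x => x \in comp G i)) c; last by rewrite inE.
move=> u v ui.
have vi : adj G u v -> v \in comp G i.
  by move: ui; rewrite !inE => c uv; apply: connect_trans c (connect1 uv).
rewrite {1}/adj !in_setU1 => /orP[] /orP[/eqP ee|h].
- by rewrite -ee /= ui in e1.
- by apply: vi; rewrite /adj h.
- by rewrite -ee /= ui in e2.
- by apply: vi; rewrite /adj h orbT.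
Qed.

(** Opening [e] only enlarges components. A vertex that stops being in a small component was, before
    the opening, in the small component of an endpoint of [e]; there are at most [K] such vertices
    for each endpoint. *)
Lemma nsmall_setU1 K G e :
  nsmall K (e |: G) <= nsmall K (G :\ e) <= nsmall K (e |: G) + K.*2.
Proof.
have le i : comp_size (G :\ e) i <= comp_size (e |: G) i.
  apply/subset_leq_card/subsetP => j; rewrite !inE; apply: connect_adjS.
  by apply/subsetP => x; rewrite !inE => /andP[_ ->]; rewrite orbT.
apply/andP; split.
  by apply/subset_leq_card/subsetP => i; rewrite !inE; apply: leq_trans.
have GE : e |: G = e |: (G :\ e) by apply/setP => x; rewrite !inE; case: eqP.
set G0 := G :\ e in le GE *.
(* The component of [x] if it is small and the empty set otherwise, so that the bound [K] holds in
   both cases. *)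
pose A x := [set i | (i \in comp G0 x) && (#|comp G0 x| <= K)].
have cA x : #|A x| <= K.
  case: (leqP #|comp G0 x| K) => h.
    by apply: leq_trans h; apply/subset_leq_card/subsetP => i; rewrite inE => /andP[].
  rewrite (_ : A x = set0) ?cards0 //; apply/setP => i.
  by rewrite !inE leqNgt h andbF.
apply: (@leq_trans #|[set i : 'I_n.+1 | comp_size (e |: G) i <= K] :|: (A e.1 :|: A e.2)|); last first.
  apply: leq_trans (leq_card_setU _ _) _; rewrite leq_add2l -addnn.
  by apply: leq_trans (leq_card_setU _ _) _; rewrite leq_add.
apply/subset_leq_card/subsetP => i; rewrite !inE => iK.
have key x : x \in comp G0 i -> connect (adj G0) x i && (#|comp G0 x| <= K).
  rewrite inE => c; rewrite connect_adj_sym c /=.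
  rewrite (_ : comp G0 x = comp G0 i) //; apply/setP => k; rewrite !inE.
  by rewrite (same_connect (@connect_adj_sym _ G0) c).
case: (boolP (e.1 \in comp G0 i)) => [/key ->|e1]; first by rewrite !orbT.
case: (boolP (e.2 \in comp G0 i)) => [/key ->|e2]; first by rewrite !orbT.
apply/orP; left; apply: leq_trans iK; rewrite GE.
exact: subset_leq_card (comp_setU1 e1 e2).
Qed.

End SmallComponents.

(** * The random graph as a product measure on sets of ordered pairs *)

Section EdgeMeasure.
Variables (R : realType) (n : nat) (p : 'I_n -> 'I_n -> R).

(** Pairs that are not increasing get probability 0, so the product measure on all sets of pairs is
    carried by graphs. *)
Definition edge_prob (e : 'I_n * 'I_n) : R := if (e.1 < e.2)%N then p e.1 e.2 else 0.

Lemma wt_graph G : wt edge_prob G != 0 -> is_graph G.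
Proof.
move=> wG; apply/forallP => e; apply/implyP => eG; apply: contraNT wG => lt.
by rewrite /wt (bigD1 e) //= eG /edge_prob (negbTE lt) mul0r.
Qed.

Lemma ProbE (A : pred {set 'I_n * 'I_n}) :
  Prob p A = Ex edge_prob (fun G => (A G)%:R).
Proof.
rewrite /Prob /Ex [RHS](bigID (fun G => is_graph G && A G)) /= [X in _ = _ + X]big1 ?addr0.
  apply: eq_bigr => G /andP[gG ->]; rewrite mulr1 /graph_weight /wt.
  rewrite pair_big_dep /= [RHS](bigID (fun e : 'I_n * 'I_n => (e.1 < e.2)%N)) /=.
  rewrite [X in _ = _ * X]big1 ?mulr1 => [|e lt].
    by apply: eq_bigr => -[i j] /= lt; rewrite /edge_prob /= lt.
  case: ifP => [/(graph_lt gG) h|_]; first by rewrite h in lt.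
  by rewrite /edge_prob (negbTE lt) subr0.
move=> G; rewrite negb_and => /orP[|/negbTE ->]; last by rewrite mulr0.
by apply: contraNeq; rewrite mulf_eq0 negb_or => /andP[/wt_graph].
Qed.

End EdgeMeasure.

(** * First-moment bounds for the number of vertices in components of a given size *)

Section Expectation.
Variables (R : realType) (n : nat) (p : 'I_n.+1 -> 'I_n.+1 -> R) (a b : R).
Hypothesis p01 : forall i j : 'I_n.+1, (i < j)%N -> 0 <= p i j <= 1.
Hypothesis a0 : 0 <= a.
Hypotheses (b0 : 0 <= b) (b1 : b <= 1).
Hypothesis pab : forall i j : 'I_n.+1, (i < j)%N -> a <= p i j <= b.

Local Notation Pe := (edge_prob p).

Lemma edge_prob01 e : 0 <= Pe e <= 1.
Proof. by rewrite /edge_prob; case: ifP => [/p01 //|_]; rewrite lexx ler01. Qed.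

Lemma ncompR r G : (ncomp G r)%:R =
  r%:R * \sum_(S : {set 'I_n.+1} | #|S| == r) (is_comp G S)%:R :> R.
Proof.
rewrite ncompE natrM; congr (_ * _).
rewrite -sum1dep_card natr_sum big_mkcondr /=; apply: eq_bigr => S _.
by case: ifP.
Qed.

Lemma sum_trees (r : nat) (k : R) : 
  \sum_(S : {set 'I_n.+1} | #|S| == r) \sum_(E : {set 'I_r * 'I_r} | is_labelled_tree E) k
  = 'C(n.+1, r)%:R * (T r)%:R * k.
Proof.
rewrite sumr_const (_ : #|[pred S : {set 'I_n.+1} | #|S| == r]| = 'C(n.+1, r)); last first.
  by rewrite -[in RHS](card_ord n.+1) -card_draws cardsE.
rewrite sumr_const (_ : #|[pred E : {set 'I_r * 'I_r} | is_labelled_tree E]| = T r); last first.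
  by rewrite /T cardsE.
by rewrite -mulrnA -[LHS]mulr_natl natrM (mulrC (T r)%:R).
Qed.

Lemma emb_edges_lt (S : {set 'I_n.+1}) r (E : {set 'I_r * 'I_r}) e :
  #|S| = r -> is_graph E -> e \in emb_edges S E -> (e.1 < e.2)%N.
Proof. by move=> cS gE /imsetP[x /(graph_lt gE) lt ->] /=; rewrite (emb_mono cS). Qed.

(** For each embedded tree, the [r - 1] open edges contribute at most [b] each, and each of the at
    least [r * (n.+1 - r)] closed crossing edges at most [1 - a], hence at most [exp(-a)]. *)
Lemma ncomp_expect_le r : (0 < r)%N ->
  Ex Pe (fun G => (ncomp G r)%:R) <=
  r%:R * ('C(n.+1, r)%:R * (T r)%:R * (b ^+ r.-1 * expR (- a) ^+ (r * (n.+1 - r)))).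
Proof.
move=> r0; rewrite -sum_trees.
apply: (@le_trans _ _ (Ex Pe (fun G => r%:R * \sum_(S : {set 'I_n.+1} | #|S| == r)
    \sum_(E : {set 'I_r * 'I_r} | is_labelled_tree E)
     ((emb_edges S E \subset G) && [disjoint cross S & G])%:R))).
  apply: Ex_le => [|G /wt_graph gG]; first exact: edge_prob01.
  rewrite ncompR ler_wpM2l // ler_sum // => S /eqP cS.
  case: (boolP (is_comp G S)) => [/(is_comp_spanning_tree cS r0 gG)[E /andP[tE h]]|_]; last first.
    by rewrite sumr_ge0.
  by rewrite (bigD1 E) //= h lerDl sumr_ge0.
rewrite ExZ ler_wpM2l // Ex_sum ler_sum // => S /eqP cS.
rewrite Ex_sum ler_sum // => E tE.
have [gE cE _] := treeP tE.
rewrite Ex_cylinder ?(disjoint_emb_cross cS) //.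
have P0 e : 0 <= Pe e by case/andP: (edge_prob01 e).
have P1 e : 0 <= 1 - Pe e by rewrite subr_ge0; case/andP: (edge_prob01 e).
apply: ler_pM; rewrite ?prodr_ge0 //.
  apply: (@le_trans _ _ (\prod_(e in emb_edges S E) b)).
    apply: ler_prod => e /(emb_edges_lt cS gE) lt; rewrite P0 /edge_prob lt.
    by case/andP: (pab lt).
  by rewrite prodr_const (card_emb_edges cS) cE.
apply: (@le_trans _ _ (\prod_(e in cross S) expR (- a))).
  apply: ler_prod => e; rewrite inE => /andP[lt _]; rewrite P1 /edge_prob lt /=.
  apply: le_trans (expR_ge1Dx _); rewrite lerD2l lerN2.
  by case/andP: (pab lt).
rewrite prodr_const; apply: ler_wiXn2l; rewrite ?expR_ge0 ?card_cross //.
by rewrite -expR0 ler_expR oppr_le0.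
Qed.

(** For each embedded tree, its edges contribute at least [a] each, and each of the at most
    [r * n.+1] remaining edges touching [S] at least [1 - b]. *)
Lemma ncomp_expect_ge r :
  r%:R * ('C(n.+1, r)%:R * (T r)%:R * (a ^+ r.-1 * (1 - b) ^+ (r * n.+1))) <=
  Ex Pe (fun G => (ncomp G r)%:R).
Proof.
rewrite -sum_trees.
apply: (@le_trans _ _ (Ex Pe (fun G => r%:R * \sum_(S : {set 'I_n.+1} | #|S| == r)
    \sum_(E : {set 'I_r * 'I_r} | is_labelled_tree E)
     ((emb_edges S E \subset G) && [disjoint touch S :\: emb_edges S E & G])%:R))); last first.
  apply: Ex_le => [|G /wt_graph gG]; first exact: edge_prob01.
  rewrite ncompR ler_wpM2l // ler_sum // => S /eqP cS.
  have [E /= /andP[tE h]|no] := pickP (fun E : {set 'I_r * 'I_r} =>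
      is_labelled_tree E &&
      ((emb_edges S E \subset G) && [disjoint touch S :\: emb_edges S E & G])).
    have /andP[h1 h2] := h.
    have [-> EG] := tree_is_comp cS gG tE h1 h2.
    (* At most one term is nonzero: any other tree satisfying the condition also embeds onto
       [G :&: touch S]. *)
    rewrite (bigD1 E) //= h big1 ?addr0 // => E' /andP[tE' neq].
    case: (boolP (_ && _)) => // /andP[h1' h2']; case/eqP: neq.
    have [_ EG'] := tree_is_comp cS gG tE' h1' h2'.
    by apply: (imset_inj (@emb_edge_inj _ _ _ cS)); rewrite -!/(emb_edges S _) EG EG'.
  by rewrite big1 // => E tE; have := no E; rewrite /= tE /= => ->.
rewrite ExZ ler_wpM2l // Ex_sum ler_sum // => S /eqP cS.
rewrite Ex_sum ler_sum // => E tE.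
have [gE cE _] := treeP tE.
rewrite Ex_cylinder; last first.
  by rewrite disjoint_sym disjoints_subset setDE subsetIr.
have P0 e : 0 <= Pe e by case/andP: (edge_prob01 e).
have b1' : 0 <= 1 - b by rewrite subr_ge0.
apply: ler_pM; rewrite ?exprn_ge0 //.
  apply: (@le_trans _ _ (\prod_(e in emb_edges S E) a)).
    by rewrite prodr_const (card_emb_edges cS) cE.
  apply: ler_prod => e /(emb_edges_lt cS gE) lt; rewrite a0 /edge_prob lt.
  by case/andP: (pab lt).
apply: (@le_trans _ _ (\prod_(e in touch S :\: emb_edges S E) (1 - b))).
  rewrite prodr_const; apply: ler_wiXn2l => //.
    by rewrite lerBlDr lerDl.
  by apply: leq_trans (card_touch cS); apply: subset_leq_card; rewrite subsetDl.
apply: ler_prod => e; rewrite !inE => /andP[_ /andP[lt _]]; rewrite b1' /edge_prob lt /=.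
by rewrite lerD2l lerN2; case/andP: (pab lt).
Qed.

End Expectation.

(** * The first-moment bounds for edge probabilities of order [C / N] *)

Section ScaledBounds.
Variables (R : realType) (n : nat) (p : 'I_n.+1 -> 'I_n.+1 -> R) (C al : R).
Hypothesis p01 : forall i j : 'I_n.+1, (i < j)%N -> 0 <= p i j <= 1.
Hypothesis pC : forall i j : 'I_n.+1, (i < j)%N ->
  (C - al) / n.+1%:R <= p i j <= (C + al) / n.+1%:R.
Hypothesis al0 : 0 <= al.
Hypothesis alC : al <= C.
Hypothesis Cn : 2 * (C + al) <= n.+1%:R.

Local Notation Pe := (edge_prob p).
Local Notation N := (n.+1%:R : R).

Let N0 : 0 < N. Proof. by rewrite ltr0n. Qed.

Let a0 : 0 <= (C - al) / N.
Proof. by rewrite divr_ge0 ?subr_ge0 // ltW. Qed.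

Let Cal0 : 0 <= C + al. Proof. by move: al0 alC; lra. Qed.

Let b0 : 0 <= (C + al) / N. Proof. by rewrite divr_ge0 // ltW. Qed.

Let b2 : (C + al) / N <= 1 / 2.
Proof. by rewrite ler_pdivrMr //; move: Cn; lra. Qed.

Let b1 : (C + al) / N <= 1.
Proof. by apply: le_trans b2 _; lra. Qed.

(** The absorption identity extracts the factor [N] by which the mean is later divided. *)
Lemma mul_binE m : m.+1%:R * 'C(n.+1, m.+1)%:R = N * ((n ^_ m)%:R / m`!%:R) :> R.
Proof.
rewrite -natrM -mul_bin_diag /= natrM -bin_ffact natrM mulfK //.
Qed.

Lemma mul_bin_rearrange m (t x y : R) :
  m.+1%:R * ('C(n.+1, m.+1)%:R * t * (x * y)) =
  N * (t / m`!%:R * ((n ^_ m)%:R * x * y)).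
Proof.
transitivity (m.+1%:R * 'C(n.+1, m.+1)%:R * (t * (x * y))); first by ring.
by rewrite mul_binE; ring.
Qed.

Lemma ffact_le m : (n ^_ m)%:R <= N ^+ m.
Proof.
rewrite -natrX ler_nat ffact_prod -[m in (_ ^ m)%N]card_ord -prod_nat_const.
by apply: leq_prod => i _; rewrite (leq_trans (leq_subr _ _)).
Qed.

Lemma ffact_ge m : (m < n.+1)%N -> (N - m.+1%:R) ^+ m <= (n ^_ m)%:R.
Proof.
move=> mn; rewrite -natrB // -natrX ler_nat subSS ffact_prod.
rewrite -[X in (_ ^ X)%N](card_ord m) -prod_nat_const.
by apply: leq_prod => i _; rewrite leq_sub2l // ltnW.
Qed.

Lemma ncomp_mean_le m : Ex Pe (fun G => (ncomp G m.+1)%:R) <=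
  N * ((T m.+1)%:R / m`!%:R * (C + al) ^+ m *
   expR (- ((C - al) * m.+1%:R * (1 - m.+1%:R / N)))).
Proof.
apply: (le_trans (ncomp_expect_le p01 a0 pC (ltn0Sn m))).
rewrite mul_bin_rearrange ler_wpM2l ?(ltW N0) //.
rewrite -[leRHS]mulrA ler_wpM2l ?mulr_ge0 ?invr_ge0 //=.
rewrite ler_pM ?mulr_ge0 ?expR_ge0 ?exprn_ge0 ?expR_ge0 //.
  rewrite expr_div_n mulrCA ler_piMr ?exprn_ge0 //.
  by rewrite ler_pdivrMr ?exprn_gt0 // mul1r ffact_le.
rewrite -expRM_natl ler_expR natrM mulrN lerN2.
have -> : (C - al) * m.+1%:R * (1 - m.+1%:R / N) = m.+1%:R * (N - m.+1%:R) * ((C - al) / N).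
  by field; rewrite lt0r_neq0.
rewrite ler_wpM2r // ler_wpM2l //.
(* For [m.+1] above [n.+1] the subtraction in [nat] gives 0, while the real difference is
   negative. *)
case: (leqP m.+1 n.+1) => h; first by rewrite natrB.
by rewrite (le_trans _ (ler0n _ _)) // subr_le0 ler_nat ltnW.
Qed.

Lemma ncomp_mean_ge m : (m < n.+1)%N ->
  N * ((T m.+1)%:R / m`!%:R * ((C - al) * (1 - m.+1%:R / N)) ^+ m *
   expR (- (m.+1%:R * (C + al) / (1 - (C + al) / N))))
  <= Ex Pe (fun G => (ncomp G m.+1)%:R).
Proof.
move=> mn; apply: (le_trans _ (ncomp_expect_ge p01 a0 b0 b1 pC m.+1)).
rewrite mul_bin_rearrange ler_wpM2l ?(ltW N0) //.
rewrite -[leLHS]mulrA ler_wpM2l ?mulr_ge0 ?invr_ge0 //=.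
have e1 : (C - al) * (1 - m.+1%:R / N) = (N - m.+1%:R) * ((C - al) / N).
  by field; rewrite lt0r_neq0.
have Nm : 0 <= N - m.+1%:R by rewrite subr_ge0 ler_nat.
rewrite e1 ler_pM ?expR_ge0 ?exprn_ge0 //.
- by rewrite mulr_ge0.
- by rewrite exprMn ler_wpM2r ?exprn_ge0 // ffact_ge.
set b := (C + al) / N.
have h : 0 < 1 - b by have := b2; rewrite -/b; lra.
have Nb : C + al = N * b by rewrite /b mulrC divfK // lt0r_neq0.
have -> : - (m.+1%:R * (C + al) / (1 - b)) = (m.+1 * n.+1)%:R * (- (b / (1 - b))).
  by rewrite natrM [in LHS]Nb; ring.
rewrite expRM_natl lerXn2r ?nnegrE ?expR_ge0 ?(ltW h) //.
(* The inequality [exp(-y) <= 1 - b] with [y = b / (1 - b)] follows from [exp y >= 1 + y], as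
   [1 + y = 1 / (1 - b)]. *)
rewrite expRN invf_ple ?posrE ?expR_gt0 //.
apply: le_trans (expR_ge1Dx _); rewrite le_eqVlt; apply/orP; left; apply/eqP.
by field; rewrite lt0r_neq0.
Qed.

(** With [r = m.+1], the tree bound gives [r^m / m! = r^r / r!], which is one term of the
    exponential series at [r]. *)
Lemma exp_ge_tree m : (T m.+1)%:R / m`!%:R <= expR (m.+1%:R) :> R.
Proof.
apply: (@le_trans _ _ (m.+1%:R ^+ m / m`!%:R)).
  by rewrite ler_wpM2r ?invr_ge0 // -natrX ler_nat T_leq.
have := @expR_ge1Dxn R m.+1%:R m (ler0n _ _).
apply: le_trans; rewrite factS natrM exprS.
have -> : m.+1%:R * m.+1%:R ^+ m / (m.+1%:R * m`!%:R) = m.+1%:R ^+ m / m`!%:R :> R.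
  by rewrite -mulf_div divff ?mul1r ?pnatr_eq0.
by rewrite lerDr.
Qed.

(** With [r = m.+1], the tree factor is at most [exp r], [(C + al)^m] is at most [(C + al)^r], and
    [r / N <= eps]; the exponents add up to [r] times the left side of the assumption on [k]. *)
Lemma ncomp_mean_exp m (eps k : R) : 1 <= C + al -> m.+1%:R <= eps * N ->
  1 + ln (C + al) - (C - al) * (1 - eps) <= - k ->
  Ex Pe (fun G => (ncomp G m.+1)%:R) <= N * expR (- k * m.+1%:R).
Proof.
move=> C1 me ke; apply: (le_trans (ncomp_mean_le m)).
rewrite ler_wpM2l ?(ltW N0) //.
have C0 : 0 < C + al by lra.
apply: (@le_trans _ _ (expR (m.+1%:R) * expR (ln (C + al) * m.+1%:R) *
   expR (- ((C - al) * m.+1%:R * (1 - eps))))).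
  apply: ler_pM; rewrite ?expR_ge0 ?mulr_ge0 ?exprn_ge0 ?invr_ge0 ?(ltW C0) //.
    apply: ler_pM; rewrite ?mulr_ge0 ?exprn_ge0 ?invr_ge0 ?exp_ge_tree ?(ltW C0) //.
    rewrite expRM_natr lnK ?posrE //; exact: ler_weXn2l.
  rewrite ler_expR lerN2 ler_wpM2l ?mulr_ge0 ?subr_ge0 // lerD2l lerN2.
  by rewrite ler_pdivrMr.
rewrite -!expRD ler_expR.
have -> : m.+1%:R + ln (C + al) * m.+1%:R - (C - al) * m.+1%:R * (1 - eps)
  = (1 + ln (C + al) - (C - al) * (1 - eps)) * m.+1%:R by ring.
by rewrite ler_wpM2r.
Qed.

End ScaledBounds.

(** * Splitting the vertices by the size of their component *)

Section Decomposition.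
Variable n : nat.
Implicit Types (G : {set 'I_n.+1 * 'I_n.+1}).

Lemma comp_size_gt0 G i : (0 < comp_size G i)%N.
Proof. by apply/card_gt0P; exists i; rewrite inE connect0. Qed.

Lemma card_comp_sizeE (Q : pred nat) (B : nat) G :
  (forall i, Q (comp_size G i) -> (comp_size G i <= B)%N) ->
  #|[set i : 'I_n.+1 | Q (comp_size G i)]| = (\sum_(m < B | Q m.+1) ncomp G m.+1)%N.
Proof.
move=> QB; transitivity (\sum_(m < B | Q m.+1) \sum_(i : 'I_n.+1) (comp_size G i == m.+1))%N; last first.
  by apply: eq_bigr => m _; rewrite /ncomp -sum1dep_card [RHS]big_mkcond.
rewrite exchange_big /= -sum1dep_card [LHS]big_mkcond /=; apply: eq_bigr => i _.
have := comp_size_gt0 G i; have := QB i; case: (comp_size G i) => // r QB' _.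
case: ifP => Qr; last first.
  rewrite big1 // => m Qm; case: eqP => // -[e]; by rewrite -e Qr in Qm.
rewrite (bigD1 (Ordinal (QB' Qr))) //= eqxx big1 // => m /andP[_ ne].
by case: eqP => // -[e]; case/eqP: ne; apply: val_inj.
Qed.

Lemma nsmallE K G : nsmall K G = (\sum_(m < K) ncomp G m.+1)%N.
Proof.
rewrite /nsmall (@card_comp_sizeE (fun r => r <= K)%N K) //.
by apply: eq_bigl => m; rewrite ltn_ord.
Qed.

Variable R : realType.

Definition nmid (t u : R) G :=
  #|[set i : 'I_n.+1 | t < (comp_size G i)%:R <= u]|.

Lemma nmidE t u G :
  nmid t u G = (\sum_(m < n.+1 | (t < m.+1%:R <= u)%R) ncomp G m.+1)%N.
Proof.
apply: (@card_comp_sizeE (fun r => t < r%:R <= u)) => i _.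
by rewrite (leq_trans (max_card _)) // card_ord.
Qed.

(** The condition [K <= eps * N] keeps the small and large ranges apart, so every vertex is counted
    exactly once. *)
Lemma Y_nsmall_nmid K (eps : R) G : K%:R <= eps * n.+1%:R ->
  (Y eps G + nsmall K G + nmid K%:R (eps * n.+1%:R) G = n.+1)%N.
Proof.
move=> Ke; rewrite /Y /nsmall /nmid.
have cE (Q : pred 'I_n.+1) : #|[set i | Q i]| = (\sum_(i : 'I_n.+1) Q i)%N.
  by rewrite -sum1dep_card big_mkcond.
rewrite !cE -!big_split /= -[RHS]card_ord -sum1_card; apply: eq_bigr => i _.
rewrite ltr_nat; case: (leqP (comp_size G i) K) => h /=.
  by rewrite ltNge (le_trans _ Ke) ?ler_nat.
by case: ltP.
Qed.

End Decomposition.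

(** * Tail bound for the middle range and concentration of the small range *)

Lemma sum_geometric_le (R : realType) (x : R) B : 0 <= x < 1 ->
  \sum_(m < B) x ^+ m.+1 <= 1 / (1 - x).
Proof.
move=> /andP[x0 x1]; rewrite ler_pdivlMr ?subr_gt0 //.
under eq_bigr do rewrite exprS.
rewrite -mulr_sumr.
have := subrX1 x B; set S := \sum_(_ < _) _ => e.
have S1 : S * (1 - x) <= 1.
  have -> : S * (1 - x) = - ((x - 1) * S) by ring.
  by rewrite -e opprB lerBlDr lerDl exprn_ge0.
have S0 : 0 <= S by apply: sumr_ge0 => i _; rewrite exprn_ge0.
rewrite -mulrA (le_trans _ S1) // ler_piMl ?mulr_ge0 ?subr_ge0 ?(ltW x1) //.
Qed.

(** The decay rate is split as [s + k]: the part [s] yields [exp(-s * t)] because sizes exceed [t],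
    and the part [k] leaves a convergent geometric series. *)
Lemma nmid_mean_le (R : realType) (n : nat) (p : 'I_n.+1 -> 'I_n.+1 -> R)
  (C al eps s k t : R) :
  (forall i j : 'I_n.+1, (i < j)%N -> 0 <= p i j <= 1) ->
  (forall i j : 'I_n.+1, (i < j)%N ->
     (C - al) / n.+1%:R <= p i j <= (C + al) / n.+1%:R) ->
  0 <= al -> al <= C -> 1 <= C + al ->
  1 + ln (C + al) - (C - al) * (1 - eps) <= - (s + k) -> 0 <= s -> 0 < k ->
  Ex (edge_prob p) (fun G => (nmid t (eps * n.+1%:R) G)%:R) <=
  n.+1%:R * (expR (- s * t) / (1 - expR (- k))).
Proof.
move=> p01 pC al0 alC C1 ke s0 k0.
have -> : Ex (edge_prob p) (fun G => (nmid t (eps * n.+1%:R) G)%:R) =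
    \sum_(m < n.+1 | t < m.+1%:R <= eps * n.+1%:R) Ex (edge_prob p) (fun G => (ncomp G m.+1)%:R).
  by rewrite -Ex_sum; apply: eq_bigr => G _; rewrite nmidE natr_sum.
apply: (@le_trans _ _ (\sum_(m < n.+1 | t < m.+1%:R <= eps * n.+1%:R)
    n.+1%:R * (expR (- s * t) * expR (- k) ^+ m.+1))).
  apply: ler_sum => m /andP[tm me].
  apply: (le_trans (ncomp_mean_exp p01 pC al0 alC C1 me ke)).
  rewrite ler_wpM2l // -expRM_natr -expRD ler_expR opprD mulrDl lerD2r.
  by rewrite !mulNr lerN2 ler_wpM2l // ltW.
apply: (@le_trans _ _ (\sum_(m < n.+1) n.+1%:R * (expR (- s * t) * expR (- k) ^+ m.+1))).
  rewrite big_mkcond /=; apply: ler_sum => m _; case: ifP => _; first exact: lexx.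
  by rewrite !mulr_ge0 ?exprn_ge0 ?expR_ge0.
rewrite -!mulr_sumr ler_wpM2l // ler_wpM2l ?expR_ge0 //.
rewrite -[leRHS]mul1r sum_geometric_le // expR_ge0 expR_lt1 oppr_lt0 //.
Qed.

(** Chebyshev's inequality with oscillation [2 * K]; the sum of the edge probabilities is bounded by
    [b] times the number of all ordered pairs. *)
Lemma nsmall_deviation (R : realType) (n K : nat) (p : 'I_n.+1 -> 'I_n.+1 -> R)
  (b t : R) :
  (forall i j : 'I_n.+1, (i < j)%N -> 0 <= p i j <= 1) ->
  (forall i j : 'I_n.+1, (i < j)%N -> p i j <= b) -> 0 <= b -> 0 < t ->
  Ex (edge_prob p) (fun G => (t <= `|(nsmall K G)%:R
       - Ex (edge_prob p) (fun G => (nsmall K G)%:R)|)%R%:R) <=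
  (2 * K%:R) ^+ 2 * (n.+1%:R ^+ 2 * b) / t ^+ 2.
Proof.
move=> p01 pb b0 t0.
apply: (le_trans (Ex_chebyshev (edge_prob01 p01) (K := 2 * K%:R) t0 _)).
  move=> e G; have /andP[h1 h2] := nsmall_setU1 K G e.
  rewrite ler_norml; move: h1 h2.
  rewrite -!(ler_nat R) natrD -mul2n natrM => h1 h2.
  by apply/andP; split; move: h1 h2; lra.
rewrite ler_wpM2r ?invr_ge0 ?exprn_ge0 ?(ltW t0) // ler_wpM2l ?sqr_ge0 //.
apply: (@le_trans _ _ (\sum_(e : 'I_n.+1 * 'I_n.+1) b)).
  by apply: ler_sum => e _; rewrite /edge_prob; case: ifP => // /pb.
by rewrite sumr_const card_prod card_ord -[leLHS]mulr_natl natrM lexx.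
Qed.

(** * Limiting densities of component sizes and convergence of the series for [q] *)

Section Limit.
Local Open Scope classical_set_scope.
Local Open Scope ring_scope.
Variables (R : realType) (C : R) (alpha : nat -> R)
  (p : forall n : nat, 'I_n -> 'I_n -> R).
Hypothesis alpha0 : forall n, 0 <= alpha n.
Hypothesis alpha_cvg : (alpha n @[n --> \oo] --> 0).
Hypothesis p01 : forall n (i j : 'I_n), (i < j)%N -> 0 <= @p n i j <= 1.
Hypothesis pC : forall n (i j : 'I_n), (i < j)%N ->
  (C - alpha n) / n%:R <= @p n i j <= (C + alpha n) / n%:R.
Hypothesis C0 : 0 < C.

Let a n := alpha n.+1.
Let h n : R := n.+1%:R^-1.

Let a_cvg : (a n @[n --> \oo] --> 0).
Proof. by have := alpha_cvg; rewrite -cvg_shiftS. Qed.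

Let h_cvg : (h n @[n --> \oo] --> 0).
Proof. exact: cvg_harmonic. Qed.

Lemma near_alpha_le e : 0 < e -> (\forall n \near \oo, a n <= e).
Proof. by move=> e0; exact: (cvgr_le _ a_cvg). Qed.

Lemma near_nat_ge (x : R) : (\forall n \near \oo, x <= n.+1%:R).
Proof.
have := nbhs_infty_ger x; apply: filterS => n xn.
by rewrite (le_trans xn) // ler_nat.
Qed.

Lemma ncomp_mean_cvg m :
  (Ex (edge_prob (@p n.+1)) (fun G => (ncomp G m.+1)%:R) / n.+1%:R
    @[n --> \oo] --> q_term C m.+1).
Proof.
have expr_cvg (u : nat -> R) (l : R) k : (u n @[n --> \oo] --> l ->
    u n ^+ k @[n --> \oo] --> l ^+ k).
  move=> ul; apply: (@continuous_cvg _ _ _ _ _ u (fun x : R => x ^+ k) l) => //.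
  exact: exprn_continuous.
have expR_cvg (u : nat -> R) (l : R) : (u n @[n --> \oo] --> l ->
    expR (u n) @[n --> \oo] --> expR l).
  move=> ul; apply: (@continuous_cvg _ _ _ _ _ u expR l) => //.
  exact: continuous_expR.
have cc (x : R) : ((fun=> x) n @[n --> \oo] --> x) by exact: cvg_cst.
have m_cvg : (1 - m.+1%:R * h n @[n --> \oo] --> (1 - m.+1%:R * 0 : R)).
  by apply: cvgB => //; apply: cvgM.
have qE : q_term C m.+1 = (T m.+1)%:R / m`!%:R * C ^+ m * expR (- (C * m.+1%:R)).
  by rewrite /q_term /=; ring.
(* The lower and upper first-moment bounds, divided by [n.+1], have the same limit. *)
apply: (@squeeze_cvgr _ _ _ _
  (fun n => (T m.+1)%:R / m`!%:R * ((C - a n) * (1 - m.+1%:R * h n)) ^+ m *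
     expR (- (m.+1%:R * (C + a n) / (1 - (C + a n) * h n))))
  (fun n => (T m.+1)%:R / m`!%:R * (C + a n) ^+ m *
     expR (- ((C - a n) * m.+1%:R * (1 - m.+1%:R * h n))))).
- near=> n.
  have N0 : 0 < n.+1%:R :> R by rewrite ltr0n.
  have aC : a n <= C by near: n; exact: near_alpha_le.
  have Cn : 2 * (C + a n) <= n.+1%:R.
    apply: (@le_trans _ _ (4 * C)); first by move: aC; lra.
    by near: n; exact: near_nat_ge.
  have mn : (m < n.+1)%N by near: n; exists m.
  have pn01 (i j : 'I_n.+1) : (i < j)%N -> 0 <= @p n.+1 i j <= 1 by exact: p01.
  have pnC (i j : 'I_n.+1) : (i < j)%N -> (C - a n) / n.+1%:R <= @p n.+1 i j <= (C + a n) / n.+1%:R.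
    exact: pC.
  apply/andP; split.
    rewrite ler_pdivlMr // [leLHS]mulrC.
    exact: (ncomp_mean_ge pn01 pnC (alpha0 _) aC Cn mn).
  rewrite ler_pdivrMr // [leRHS]mulrC.
  exact: (ncomp_mean_le pn01 pnC (alpha0 _) aC m).
- have -> : q_term C m.+1 = (T m.+1)%:R / m`!%:R * ((C - 0) * (1 - m.+1%:R * 0)) ^+ m *
     expR (- (m.+1%:R * (C + 0) / (1 - (C + 0) * 0))).
    by rewrite qE !(mulr0, subr0, addr0, mulr1, divr1) (mulrC C).
  apply: cvgM; first by apply: cvgM => //; apply: expr_cvg; apply: cvgM => //; apply: cvgB.
  apply: expR_cvg; apply: cvgN; apply: cvgM.
    by apply: cvgM => //; apply: cvgD.
  apply: cvgV; first by rewrite mulr0 subr0 oner_neq0.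
  by apply: cvgB => //; apply: cvgM => //; apply: cvgD.
- have -> : q_term C m.+1 = (T m.+1)%:R / m`!%:R * (C + 0) ^+ m *
     expR (- ((C - 0) * m.+1%:R * (1 - m.+1%:R * 0))).
    by rewrite qE !(mulr0, subr0, addr0, mulr1).
  apply: cvgM; first by apply: cvgM => //; apply: expr_cvg; apply: cvgD.
  by apply: expR_cvg; apply: cvgN; apply: cvgM => //; apply: cvgM => //; apply: cvgB.
Unshelve. all: by end_near. Qed.

Lemma nsmall_mean_cvg K :
  (Ex (edge_prob (@p n.+1)) (fun G => (nsmall K G)%:R) / n.+1%:R
    @[n --> \oo] --> \sum_(m < K) q_term C m.+1).
Proof.
have -> : (fun n => Ex (edge_prob (@p n.+1)) (fun G => (nsmall K G)%:R) / n.+1%:R)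
  = (fun n => \sum_(m < K) (Ex (edge_prob (@p n.+1)) (fun G => (ncomp G m.+1)%:R) / n.+1%:R)).
  apply/funext => n; rewrite -mulr_suml -Ex_sum; congr (_ / _).
  by apply: eq_bigr => G _; rewrite nsmallE natr_sum.
elim: K => [|K IH].
  by under eq_fun do rewrite big_ord0; rewrite big_ord0; exact: cvg_cst.
under eq_fun do rewrite big_ord_recr; rewrite big_ord_recr /=.
by apply: cvgD => //; exact: ncomp_mean_cvg.
Qed.

(** The partial sum is a limit of expected proportions of vertices, each at most 1. *)
Lemma q_partial_le1 K : \sum_(m < K) q_term C m.+1 <= 1.
Proof.
apply: (cvgr_to_le (@nsmall_mean_cvg K)); apply: nearW => n.
rewrite ler_pdivrMr ?ltr0n // mul1r -[leRHS](Ex_cst (edge_prob (@p n.+1))).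
apply: Ex_le => [|G _]; first by apply: edge_prob01; exact: p01.
by rewrite ler_nat (leq_trans (max_card _)) // card_ord.
Qed.

Lemma q_term_ge0 r : 0 <= q_term C r.
Proof. by rewrite /q_term !mulr_ge0 ?invr_ge0 ?expR_ge0 ?exprn_ge0 // ltW. Qed.

(** [q] is a [limn], whose value is meaningful once the sequence converges; here the terms are
    nonnegative and the partial sums bounded by 1. *)
Lemma q_cvg : (\sum_(m < K) q_term C m.+1 @[K --> \oo] --> q C).
Proof.
have -> : (fun K => \sum_(m < K) q_term C m.+1) = (fun K => \sum_(1 <= r < K.+1) q_term C r).
  by apply/funext => K; rewrite big_add1 big_mkord.
have nd : nondecreasing_seq (fun N => \sum_(1 <= r < N) q_term C r).
  apply/nondecreasing_seqP => -[|N]; first by rewrite !big_geq.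
  by rewrite [leRHS]big_nat_recr //= lerDl q_term_ge0.
have cv : cvgn (fun N => \sum_(1 <= r < N) q_term C r).
  apply: nondecreasing_is_cvgn => //; exists 1 => _ [[|N] _ <-].
    by rewrite big_geq.
  by rewrite big_add1 big_mkord q_partial_le1.
by rewrite (cvg_shiftS (fun N => \sum_(1 <= r < N) q_term C r)).
Qed.

End Limit.

(** * Choice of constants and assembly of the three bad events *)

Local Open Scope classical_set_scope.
Local Open Scope ring_scope.
(** [m] stands for the mean of [nsmall]. The two errors on [nsmall] and the size of the middle range
    cost [gamma / 4 * N] each, so [Y] is within [3 * gamma / 4 * N] of [(1 - q C) * N]. *)
Lemma H2_criterion (R : realType) (n K : nat) (C M gamma eps m : R)
  (G : {set 'I_n.+1 * 'I_n.+1}) :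
  K%:R <= eps * n.+1%:R ->
  `|m / n.+1%:R - q C| <= gamma / 4 ->
  `|(nsmall K G)%:R - m| < gamma / 4 * n.+1%:R ->
  (nmid K%:R (eps * n.+1%:R) G)%:R < gamma / 4 * n.+1%:R ->
  (nmid (M * ln n.+1%:R) (eps * n.+1%:R) G < 1)%N ->
  H2 C M gamma eps G.
Proof.
move=> Ke mq Zm W1 no; set N := n.+1%:R in Ke mq Zm W1 *.
have N0 : 0 < N by rewrite ltr0n.
have {mq} mq : `|m - q C * N| <= gamma / 4 * N.
  have -> : m - q C * N = (m / N - q C) * N by rewrite mulrBl divfK // lt0r_neq0.
  by rewrite normrM (gtr0_norm N0) ler_wpM2r // ltW.
apply/andP; split; last first.
  apply/forallP => j; rewrite ltnS leqn0 cards_eq0 in no.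
  case: (lerP _ (M * _)) => //= h; rewrite ltNge; apply/negP => h'.
  by have := in_set0 j; rewrite -(eqP no) inE h h'.
have /(congr1 (fun k : nat => k%:R : R)) := Y_nsmall_nmid G Ke.
rewrite !natrD -/N => e.
have W0 : 0 <= (nmid K%:R (eps * N) G)%:R :> R by [].
move: mq Zm; rewrite ler_norml ltr_norml => /andP[m1 m2] /andP[z1 z2].
by apply/andP; split; move: e W0 W1 m1 m2 z1 z2; rewrite -/N; lra.
Qed.

(** The logarithm and the factor [C - al] each lose at most [al <= k / 2], and [eps] loses at most
    [C * eps <= k]. *)
Lemma ln_perturbation (R : realType) (C al eps k : R) : 1 < C -> 0 <= al ->
  al <= k / 2 -> 0 <= eps -> C * eps <= k ->
  1 + ln (C + al) - (C - al) * (1 - eps) <= - (C - 1 - ln C - 2 * k).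
Proof.
move=> C1 al0 alk eps0 Ck; have C0 : 0 < C by lra.
have : ln (C + al) <= ln C + al.
  have -> : C + al = C * (1 + al / C) by rewrite mulrDr mulr1 mulrCA divff ?mulr1 // lt0r_neq0.
  have aC : 0 <= al / C by rewrite divr_ge0 // ltW.
  rewrite lnM ?posrE //; last by lra.
  rewrite lerD2l; apply: le_trans (le_ln1Dx _) _; first by lra.
  by rewrite ler_pdivrMr // ler_peMr // ltW.
have : 0 <= al * eps by rewrite mulr_ge0.
have -> : (C - al) * (1 - eps) = C - al - C * eps + al * eps by ring.
by lra.
Qed.

Theorem theorem4 (R : realType) (C : R) (alpha : nat -> R)
  (p : forall n : nat, 'I_n -> 'I_n -> R) (M gamma : R) :
  (forall n, 0 <= alpha n) ->
  alpha @ \oo --> 0 ->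
  (forall n (i j : 'I_n), (i < j)%N -> 0 <= p n i j <= 1) ->
  (forall n (i j : 'I_n), (i < j)%N ->
     (C - alpha n) / n%:R <= p n i j <= (C + alpha n) / n%:R) ->
  1 < C ->
  1 / (C - 1 - ln C) < M ->
  0 < gamma < 1 ->
  exists eps1 : R, 0 < eps1 /\
    forall eps : R, 0 < eps < eps1 ->
      exists L3 : nat, forall n : nat, (L3 <= n)%N ->
        1 - gamma <= Prob (p n) (fun G => @H2 R n C M gamma eps G).
Proof.
move=> alpha0 alpha_cvg p01 pC C1 Md /andP[g0 g1].
have C0 : 0 < C by lra.
pose delta := C - 1 - ln C.
have d0 : 0 < delta.
  have lnC : ln C != 0 by rewrite ln_eq0 //; apply/eqP => e; move: C1; rewrite e ltxx.
  by have := expR_gt1Dx lnC; rewrite lnK ?posrE // /delta; lra.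
have M0 : 0 < M by apply: lt_trans Md; rewrite divr_gt0.
have Md' : 1 / M < delta by rewrite ltr_pdivrMr // mulrC -ltr_pdivrMr.
(* A quarter of the slack in [1 / M < delta]: then [s * M = 1 + k * M] exceeds 1, while
   [s + k = delta - 2 * k] is the rate left after perturbing [C] and [eps]. *)
pose k := (delta - 1 / M) / 4.
have k0 : 0 < k by rewrite /k; lra.
pose s := 1 / M + k.
have M10 : 0 < 1 / M by rewrite divr_gt0.
have s0 : 0 < s by rewrite /s; lra.
have sk : s + k = delta - 2 * k by rewrite /s /k; lra.
exists (k / C); split; first by rewrite divr_gt0.
move=> eps /andP[eps0 epsk].
have Ce : C * eps <= k by rewrite mulrC -ler_pdivlMr // ltW.
pose x := expR (- k).
have x1 : 0 < 1 - x by rewrite subr_gt0 expR_lt1 oppr_lt0.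
pose qK K := \sum_(m < K) q_term C m.+1.
(* The square of [gamma / 4] lets Markov's inequality at level [gamma / 4 * N] still give
   probability at most [gamma / 4]. *)
have [K [Ks Kq]] : exists K, expR (- s * K%:R) / (1 - x) <= gamma / 4 * (gamma / 4)
    /\ `|qK K - q C| <= gamma / 8.
  have g8 : 0 < gamma / 8 by lra.
  have qn : \forall K \near \oo, `|qK K - q C| <= gamma / 8.
    by apply: cvgr_distC_le g8; exact: (q_cvg alpha0 alpha_cvg p01 pC C0).
  pose c := gamma / 4 * (gamma / 4) * (1 - x).
  have c0 : 0 < c by rewrite !mulr_gt0 //; lra.
  have [K1 _ HK1] := qn.
  have [K2 _ HK2] := nbhs_infty_ger (- ln c / s).
  exists (maxn K1 K2); split; last by apply: HK1; exact: leq_maxl.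
  rewrite ler_pdivrMr // -/c -[leRHS]lnK ?posrE // ler_expR mulNr lerNl.
  by rewrite mulrC -ler_pdivrMr //; apply: HK2; exact: leq_maxr.
(* The threshold is a successor, which rules out [n = 0]. *)
suff [L _ HL] : \forall n \near \oo,
    1 - gamma <= Prob (p n.+1) (fun G => @H2 R n.+1 C M gamma eps G).
  by exists L.+1 => -[//|n]; rewrite ltnS => /HL.
have g8 : 0 < gamma / 8 by lra.
have meanK : \forall n \near \oo,
    `|Ex (edge_prob (p n.+1)) (fun G => (nsmall K G)%:R) / n.+1%:R - qK K| <= gamma / 8.
  by apply: cvgr_distC_le g8; exact: (nsmall_mean_cvg alpha0 alpha_cvg p01 pC).
have k20 : 0 < k / 2 by lra.
near=> n.
set N := n.+1%:R : R.
have N0 : 0 < N by rewrite ltr0n.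
set al := alpha n.+1.
have al0 : 0 <= al by exact: alpha0.
have alk : al <= k / 2 by rewrite /al; near: n; exact: near_alpha_le.
have alC : al <= C by rewrite /al; near: n; exact: near_alpha_le.
have pn01 (i j : 'I_n.+1) : (i < j)%N -> 0 <= p n.+1 i j <= 1 by exact: p01.
have pnC (i j : 'I_n.+1) : (i < j)%N -> (C - al) / N <= p n.+1 i j <= (C + al) / N.
  exact: pC.
set P := edge_prob (p n.+1).
have P01 : forall e, 0 <= P e <= 1 by exact: edge_prob01.
pose m := Ex P (fun G => (nsmall K G)%:R).
have mK : `|m / N - qK K| <= gamma / 8 by rewrite /m /P /N; near: n.
have mq : `|m / N - q C| <= gamma / 4.
  apply: (le_trans (ler_distD (qK K) _ _)).
  by move: mK Kq; lra.
have Ke : K%:R <= eps * N.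
  by rewrite mulrC -ler_pdivrMr //; rewrite /N; near: n; exact: near_nat_ge.
have exponent : 1 + ln (C + al) - (C - al) * (1 - eps) <= - (s + k).
  by rewrite sk; apply: ln_perturbation => //; exact: ltW.
have C1' : 1 <= C + al by lra.
have mid t := nmid_mean_le t pn01 pnC al0 alC C1' exponent (ltW s0) k0.
have gN : 0 < gamma / 4 * N by rewrite mulr_gt0 //; lra.
pose bad1 (G : {set 'I_n.+1 * 'I_n.+1}) : bool := gamma / 4 * N <= `|(nsmall K G)%:R - m|.
pose bad2 (G : {set 'I_n.+1 * 'I_n.+1}) : bool := gamma / 4 * N <= (nmid K%:R (eps * N) G)%:R.
pose bad3 (G : {set 'I_n.+1 * 'I_n.+1}) : bool := 1 <= (nmid (M * ln N) (eps * N) G)%:R :> R.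
have E1 : Ex P (fun G => (bad1 G)%:R) <= gamma / 4.
  have b0 : 0 <= (C + al) / N by rewrite divr_ge0 ?(ltW N0) //; lra.
  have pb (i j : 'I_n.+1) : (i < j)%N -> p n.+1 i j <= (C + al) / N.
    by move=> /pnC /andP[].
  apply: (le_trans (nsmall_deviation K pn01 pb b0 gN)).
  (* The edge bound of order [1 / N] makes the variance linear in [N], so the Chebyshev bound is a
     bounded factor over [N]. *)
  have -> : (2 * K%:R) ^+ 2 * (N ^+ 2 * ((C + al) / N)) / (gamma / 4 * N) ^+ 2
    = (2 * K%:R) ^+ 2 * (C + al) * 16 / gamma ^+ 2 / N.
    by field; rewrite !lt0r_neq0.
  rewrite ler_pdivrMr // -[leRHS]mulrC -ler_pdivrMr; last by lra.
  apply: (@le_trans _ _ ((2 * K%:R) ^+ 2 * (2 * C) * 16 / gamma ^+ 2 / (gamma / 4))).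
    rewrite !ler_wpM2r ?invr_ge0 ?sqr_ge0 //; first by lra.
    by rewrite ler_wpM2l ?sqr_ge0 //; lra.
  by rewrite /N; near: n; exact: near_nat_ge.
have E2 : Ex P (fun G => (bad2 G)%:R) <= gamma / 4.
  apply: (le_trans (Ex_markov P01 gN _)) => //.
  rewrite ler_pdivrMr // (le_trans (mid _)) //.
  have -> : gamma / 4 * (gamma / 4 * N) = N * (gamma / 4 * (gamma / 4)) by ring.
  by rewrite ler_wpM2l ?(ltW N0).
have E3 : Ex P (fun G => (bad3 G)%:R) <= gamma / 4.
  apply: (le_trans (Ex_markov P01 ltr01 _)) => //.
  rewrite divr1 (le_trans (mid _)) // -/N -/x.
  rewrite mulrA ler_pdivrMr // -{1}(lnK (x := N)) ?posrE // -expRD.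
  pose c := gamma / 4 * (1 - x).
  have c0 : 0 < c by rewrite mulr_gt0 //; lra.
  rewrite -/c -[leRHS]lnK ?posrE // ler_expR.
  (* As [s * M = 1 + k * M], the factor [N] is absorbed and [N^(-k * M)] remains, which tends to
     0. *)
  have -> : ln N + - s * (M * ln N) = - (k * M * ln N).
    by rewrite /s; field; rewrite lt0r_neq0.
  rewrite lerNl mulrC -ler_pdivrMr ?(mulr_gt0 k0 M0) //.
  rewrite -[leLHS]expRK ler_ln ?posrE ?expR_gt0 //.
  by rewrite /N; near: n; exact: near_nat_ge.
rewrite ProbE -/P.
(* Union bound: the indicator of [H2] is at least 1 minus the sum of the indicators of the bad
   events, whose total mean is at most [3 * gamma / 4]. *)
apply: (@le_trans _ _ (Ex P (fun G => 1 + - 1 * ((bad1 G)%:R + ((bad2 G)%:R + (bad3 G)%:R))))).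
  by rewrite ExD ExZ !ExD Ex1; move: E1 E2 E3; lra.
apply: Ex_le => // G _.
case: (boolP (H2 _ _ _ _ _)) => [_|]; first by rewrite mulN1r gerBl !addr_ge0.
apply: contraNT; rewrite -ltNge => lt0.
move: lt0; rewrite /=.
case: (boolP (bad1 G)) => b1; first by case: (bad2 G); case: (bad3 G) => /=; lra.
case: (boolP (bad2 G)) => b2; first by case: (bad3 G) => /=; lra.
case: (boolP (bad3 G)) => b3; first by move=> /=; lra.
move=> _; rewrite -ltNge in b1; rewrite -ltNge in b2.
apply: (H2_criterion Ke mq b1 b2).
by rewrite -(ltr_nat R) ltNge.
Unshelve. all: by end_near. Qed.
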